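(* For the charged squashed Kaluza–Klein black hole metric with geodesic Lagrangian $$\mathcal L=-f(r)\dot t^2+\frac{k^2(r)}{f(r)}\dot r^2+\frac{r^2}{4}k(r)\dot\theta^2+\frac{r^2}{4}\left[k(r)\sin^2\theta+\cos^2\theta\right]\dot\varphi^2+\frac{r^2}{2}\cos\theta\,\dot\varphi\dot\psi+\frac{r^2}{4}\dot\psi^2,$$ the following six functions $T_i$ are conserved flows of the system of geodesic equations, corresponding (up to sign) to the Noether symmetries $\mathbf Y_i$, $i=1,\dots,6$; that is, $D_sT_i=0$ along every solution of the geodesic equations: - for $\mathbf Y_1=\partial_s$: $T_1=\mathcal L$; - for $\mathbf Y_2=\partial_t$: $T_2=-2f(r)\dot t$; - for $\mathbf Y_3=\partial_\varphi$: $T_3=\frac{r^2}{2}\left[k(r)\sin^2\theta+\cos^2\theta\right]\dot\varphi+\frac{r^2}{2}\cos\theta\,\dot\psi$; - for $\mathbf Y_4=\partial_\psi$: $T_4=\frac{r^2}{2}\cos\theta\,\dot\varphi+\frac{r^2}{2}\dot\psi$; - for $\mathbf Y_5=\sin\varphi\,\partial_\theta+\cos\varphi\cot\theta\,\partial_\varphi-\cos\varphi\csc\theta\,\partial_\psi$: $T_5=\frac{r^2}{2}k(r)\sin\varphi\,\dot\theta+\frac{r^2}{4}\left[k(r)-1\right]\sin2\theta\cos\varphi\,\dot\varphi+\frac{r^2}{2}\left[\cos\theta\cos\varphi\cot\theta-\cos\varphi\csc\theta\right]\dot\psi$; - for $\mathbf Y_6=\cos\varphi\,\partial_\theta-\sin\varphi\cot\theta\,\partial_\varphi+\sin\varphi\csc\theta\,\partial_\psi$: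 $T_6=\frac{r^2}{2}k(r)\cos\varphi\,\dot\theta-\frac{r^2}{4}\left[k(r)-1\right]\sin2\theta\sin\varphi\,\dot\varphi+\frac{r^2}{2}\left[\sin\varphi\csc\theta-\cos\theta\sin\varphi\cot\theta\right]\dot\psi$.
   Context: The metric is $ds^2=-f(r)\,dt^2+\frac{k^2(r)}{f(r)}\,dr^2+\frac{r^2}{4}\left[k(r)(\sigma_1^2+\sigma_2^2)+\sigma_3^2\right]$ in coordinates $(x^1,\dots,x^5)=(t,r,\theta,\varphi,\psi)$ with $0\le\theta<\pi$, $0\le\varphi<2\pi$, $0\le\psi<2\pi$, $0<r<r_\infty$ (restricted to the open region where the metric is defined and nondegenerate), where $$\sigma_1=\cos\psi\,d\theta+\sin\psi\sin\theta\,d\varphi,\quad \sigma_2=-\sin\psi\,d\theta+\cos\psi\sin\theta\,d\varphi,\quad \sigma_3=d\psi+\cos\theta\,d\varphi,$$ $$f(r)=1-\frac{2M}{r^2}+\frac{q^2}{r^4},\qquad k(r)=\frac{f(r_\infty)\,r_\infty^4}{(r^2-r_\infty^2)^2},$$ with $M,q$ real constants (mass and charge of the black hole) and $r_\infty>0$ a constant. The dot denotes $d/ds$, $D_s$ is the total derivative with respect to $s$, and the geodesic equations are the Euler–Lagrange equations of $\mathcal L(s,x,\dot x)=g_{\mu\nu}\dot x^\mu\dot x^\nu$. The conserved flow corresponding to a Noether symmetry $\mathbf Y=\xi\,\partial_s+\eta^\mu\,\partial_{x^\mu}$ with gauge function $A=0$ is $T=\xi\mathcal L+(\eta^\mu-\dot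 x^\mu\xi)\frac{\partial\mathcal L}{\partial\dot x^\mu}$, up to an overall sign. *)

(* Defs.v *)
From Stdlib Require Import Reals ZArith.
From Coquelicot Require Import Coquelicot.
Open Scope R_scope.

Inductive coord : Set := c_t | c_r | c_theta | c_phi | c_psi.

Definition coord_eq_dec (mu nu : coord) : {mu = nu} + {mu <> nu}.
Proof. decide equality. Defined.

Definition vec := coord -> R.

Definition csum (F : coord -> R) : R :=
  F c_t + F c_r + F c_theta + F c_phi + F c_psi.

Definition upd (x : vec) (mu : coord) (h : R) : vec :=
  fun nu => if coord_eq_dec mu nu then h else x nu.

(* [Derive] is total, hence meaningful only where the derivative exists; below,
   it is applied to functions that are smooth at the points considered. *)
Definition partial (F : vec -> R) (x : vec) (mu : coord) : R :=
  Derive (fun h => F (upd x mu h)) (x mu).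

Definition lagrangian_fun := R -> vec -> vec -> R.

Definition dL_dx (L : lagrangian_fun) (s : R) (x v : vec) (mu : coord) : R :=
  partial (fun y => L s y v) x mu.

Definition dL_dv (L : lagrangian_fun) (s : R) (x v : vec) (mu : coord) : R :=
  partial (fun w => L s x w) v mu.

(* D_s on functions of (s, x) only: no second derivative of x occurs. *)
Definition total_D (F : R -> vec -> R) (s : R) (x v : vec) : R :=
  Derive (fun u => F u x) s + csum (fun mu => v mu * partial (F s) x mu).

(* xi d/ds + eta^mu d/dx^mu *)
Record vector_field := VectorField {
  xi : R -> vec -> R;
  eta : R -> vec -> coord -> R
}.

(* Y^[1] L, with
   Y^[1] = Y + (D_s eta^mu - xdot^mu D_s xi) d/d xdot^mu. *)
Definition prolong1 (Y : vector_field) (L : lagrangian_fun)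
    (s : R) (x v : vec) : R :=
  xi Y s x * Derive (fun u => L u x v) s
  + csum (fun mu => eta Y s x mu * dL_dx L s x v mu)
  + csum (fun mu =>
      (total_D (fun u y => eta Y u y mu) s x v - v mu * total_D (xi Y) s x v)
      * dL_dv L s x v mu).

Definition noether_symmetry (D : vec -> Prop) (L : lagrangian_fun)
    (Y : vector_field) (A : R -> vec -> R) : Prop :=
  forall (s : R) (x v : vec), D x ->
    prolong1 Y L s x v + L s x v * total_D (xi Y) s x v = total_D A s x v.

(* For gauge function A = 0. *)
Definition noether_flow (L : lagrangian_fun) (Y : vector_field) : lagrangian_fun :=
  fun s x v =>
    xi Y s x * L s x v
    + csum (fun mu => (eta Y s x mu - v mu * xi Y s x) * dL_dv L s x v mu).

Definition velocity (x : R -> vec) (s : R) : vec :=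
  fun mu => Derive (fun u => x u mu) s.

(* phi and psi are angles: along a curve they may be followed continuously
   beyond the interval [0, 2 pi), so x is compared with a chart point y
   modulo 2 pi in these two coordinates. *)
Definition same_point (x y : vec) : Prop :=
  x c_t = y c_t /\ x c_r = y c_r /\ x c_theta = y c_theta /\
  (exists m : Z, x c_phi = y c_phi + 2 * PI * IZR m) /\
  (exists n : Z, x c_psi = y c_psi + 2 * PI * IZR n).

(* Twice differentiable solutions, on the open interval (a, b), of
   d/ds (dL/d xdot^mu) = dL/dx^mu. *)
Definition solves_euler_lagrange (D : vec -> Prop) (L : lagrangian_fun)
    (a b : Rbar) (x : R -> vec) : Prop :=
  forall s : R, Rbar_lt a s -> Rbar_lt s b ->
    (exists y : vec, D y /\ same_point (x s) y) /\
    (forall mu, ex_derive (fun u => x u mu) s) /\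
    (forall mu, ex_derive (fun u => velocity x u mu) s) /\
    (forall mu, is_derive (fun u => dL_dv L u (x u) (velocity x u) mu) s
                          (dL_dx L s (x s) (velocity x s) mu)).

(* Along a curve, D_s T is the derivative of s |-> T(s, x(s), xdot(s)). *)
Definition conserved (D : vec -> Prop) (L T : lagrangian_fun) : Prop :=
  forall (a b : Rbar) (x : R -> vec), solves_euler_lagrange D L a b x ->
    forall s : R, Rbar_lt a s -> Rbar_lt s b ->
      is_derive (fun u => T u (x u) (velocity x u)) s 0.

Definition conserved_flow_of (D : vec -> Prop) (L : lagrangian_fun)
    (Y : vector_field) (T : lagrangian_fun) : Prop :=
  noether_symmetry D L Y (fun _ _ => 0) /\
  (exists sign : R, (sign = 1 \/ sign = -1) /\
     forall (s : R) (x v : vec), D x -> T s x v = sign * noether_flow L Y s x v) /\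
  conserved D L T.

Definition bh_f (M q r : R) : R :=
  1 - 2 * M / r ^ 2 + q ^ 2 / r ^ 4.

Definition bh_k (M q rinf r : R) : R :=
  bh_f M q rinf * rinf ^ 4 / (r ^ 2 - rinf ^ 2) ^ 2.

(* dx mu nu is the nu-th component of the one-form dx^mu. *)
Definition dx (mu nu : coord) : R := if coord_eq_dec mu nu then 1 else 0.

Definition sigma1 (x : vec) (mu : coord) : R :=
  cos (x c_psi) * dx c_theta mu + sin (x c_psi) * sin (x c_theta) * dx c_phi mu.

Definition sigma2 (x : vec) (mu : coord) : R :=
  - sin (x c_psi) * dx c_theta mu + cos (x c_psi) * sin (x c_theta) * dx c_phi mu.

Definition sigma3 (x : vec) (mu : coord) : R :=
  dx c_psi mu + cos (x c_theta) * dx c_phi mu.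

Definition metric (M q rinf : R) (x : vec) (mu nu : coord) : R :=
  let r := x c_r in
  - bh_f M q r * (dx c_t mu * dx c_t nu)
  + bh_k M q rinf r ^ 2 / bh_f M q r * (dx c_r mu * dx c_r nu)
  + r ^ 2 / 4 *
    (bh_k M q rinf r * (sigma1 x mu * sigma1 x nu + sigma2 x mu * sigma2 x nu)
     + sigma3 x mu * sigma3 x nu).

Definition metric_nondegenerate (M q rinf : R) (x : vec) : Prop :=
  forall v : vec,
    (forall mu, csum (fun nu => metric M q rinf x mu nu * v nu) = 0) ->
    forall nu, v nu = 0.

(* For 0 < r < rinf the only denominator in the metric that can vanish is f(r).
   Nondegeneracy removes theta = 0 and forces f(rinf) <> 0. *)
Definition region (M q rinf : R) (x : vec) : Prop :=
  0 < x c_r < rinf /\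
  0 <= x c_theta < PI /\
  0 <= x c_phi < 2 * PI /\
  0 <= x c_psi < 2 * PI /\
  bh_f M q (x c_r) <> 0 /\
  metric_nondegenerate M q rinf x.

Definition Lagr (M q rinf : R) : lagrangian_fun := fun _ x v =>
  csum (fun mu => csum (fun nu => metric M q rinf x mu nu * v mu * v nu)).

Definition cot (u : R) : R := cos u / sin u.
Definition csc (u : R) : R := / sin u.

Definition Y1 : vector_field := VectorField (fun _ _ => 1) (fun _ _ _ => 0).

Definition Y2 : vector_field := VectorField (fun _ _ => 0) (fun _ _ => dx c_t).

Definition Y3 : vector_field := VectorField (fun _ _ => 0) (fun _ _ => dx c_phi).

Definition Y4 : vector_field := VectorField (fun _ _ => 0) (fun _ _ => dx c_psi).

Definition Y5 : vector_field := VectorField (fun _ _ => 0) (fun _ x mu =>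
  match mu with
  | c_theta => sin (x c_phi)
  | c_phi => cos (x c_phi) * cot (x c_theta)
  | c_psi => - (cos (x c_phi) * csc (x c_theta))
  | _ => 0
  end).

Definition Y6 : vector_field := VectorField (fun _ _ => 0) (fun _ x mu =>
  match mu with
  | c_theta => cos (x c_phi)
  | c_phi => - (sin (x c_phi) * cot (x c_theta))
  | c_psi => sin (x c_phi) * csc (x c_theta)
  | _ => 0
  end).

(* Main.v *)
Require Import Defs.
From Stdlib Require Import Reals ZArith Lra FunctionalExtensionality.
From Coquelicot Require Import Coquelicot.
Open Scope R_scope.

(** The six conservation laws are instances of Noether's theorem
    ([noether_theorem]): along a solution, the derivative of the flow of a
    vector field [Y] is [Y^[1] L + L D_s xi], hence vanishes when [Y] is a
    symmetry with zero gauge function.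

    The symmetries come from the shape of the metric alone.  As
    [sigma1^2 + sigma2^2 = dtheta^2 + sin^2 theta dphi^2] does not involve [psi],
    the Lagrangian is
      [A vt^2 + B vr^2 + C (vtheta^2 + sin^2 theta vphi^2)
       + E (vpsi + cos theta vphi)^2]
    with [A], [B], [C], [E] functions of [r] only ([Lagr_biaxial]).  The variables
    [s], [t], [phi], [psi] are cyclic, which gives the first four symmetries.  The
    last two are infinitesimal rotations of the sphere [(theta, phi)], lifted to
    the [psi] direction so that they preserve the connection form [sigma3]; they
    have a common form in terms of a function [a] of [phi] with [a'' = -a]
    ([rotation_field]), where [a] is [sin] or [cos].  For each field the symmetry
    condition is then a trigonometric identity between the explicit gradients of
    the Lagrangian.

    Two points need care.  A solution is only assumed to lie in the chart modulo
    [2 pi] in the angles, so everything is proved on the larger set where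
    [sin theta <> 0] and the coefficients are differentiable
    ([biaxial_regular]); nondegeneracy of the metric excludes the pole
    [theta = 0].  And since the partial derivatives are taken with a total
    operator, the chain rule along the curve is established by hand for the
    Lagrangian and for each vector field. *)

(** * Noether's theorem *)

Definition chain_rule (F : R -> vec -> R) (x : R -> vec) (s : R) : Prop :=
  is_derive (fun u => F u (x u)) s (total_D F s (x s) (velocity x s)).

(** The term [velocity (velocity x)] is the acceleration of the curve. *)
Definition chain_rule_L (L : lagrangian_fun) (x : R -> vec) (s : R) : Prop :=
  is_derive (fun u => L u (x u) (velocity x u)) s
    (Derive (fun u => L u (x s) (velocity x s)) s
     + csum (fun mu => velocity x s mu * dL_dx L s (x s) (velocity x s) mu)
     + csum (fun mu =>
         velocity (velocity x) s mu * dL_dv L s (x s) (velocity x s) mu)).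

Lemma is_derive_csum (F : R -> coord -> R) (dF : coord -> R) (s : R) :
  (forall mu, is_derive (fun u => F u mu) s (dF mu)) ->
  is_derive (fun u => csum (F u)) s (csum dF).
Proof.
intros H. unfold csum.
repeat apply @is_derive_plus; apply H.
Qed.

(** By the Euler-Lagrange equations the derivative of [dL/dv^mu] is [dL/dx^mu];
    the derivatives of [xi L] and of [- v^mu xi dL/dv^mu] then produce opposite
    terms [xi v^mu dL/dx^mu] and [xi a^mu dL/dv^mu], where [a] is the
    acceleration, and what is left is the symmetry condition. *)
Lemma noether_theorem (L : lagrangian_fun) (Y : vector_field)
    (x : R -> vec) (s : R) :
  (forall mu, ex_derive (fun u => velocity x u mu) s) ->
  (forall mu, is_derive (fun u => dL_dv L u (x u) (velocity x u) mu) s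
                        (dL_dx L s (x s) (velocity x s) mu)) ->
  chain_rule_L L x s ->
  chain_rule (xi Y) x s ->
  (forall mu, chain_rule (fun u y => eta Y u y mu) x s) ->
  is_derive (fun u => noether_flow L Y u (x u) (velocity x u)) s
    (prolong1 Y L s (x s) (velocity x s)
     + L s (x s) (velocity x s) * total_D (xi Y) s (x s) (velocity x s)).
Proof.
intros Hacc HEL HL Hxi Heta. unfold noether_flow.
evar_last.
  apply @is_derive_plus.
    apply (@is_derive_mult R_AbsRing _ _ _ _ _ Hxi HL). exact Rmult_comm.
  apply is_derive_csum. intros mu.
  apply @is_derive_mult; [ | exact (HEL mu) | exact Rmult_comm].
  apply @is_derive_minus; [exact (Heta mu) | ].
  apply @is_derive_mult; [ | exact Hxi | exact Rmult_comm].
  apply Derive_correct, Hacc.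
unfold prolong1, velocity at 5, csum, minus, plus, opp, mult; simpl.
unfold mult; simpl. unfold velocity. ring.
Qed.

(** A solution may leave the chart [D], as its angles are followed beyond the
    intervals of the chart, but it stays in the larger set [U]; there the
    identity between [T] and the flow holds at all nearby parameters, and can be
    differentiated. *)
Lemma noether_conserved_flow (D U : vec -> Prop) (L T : lagrangian_fun)
    (Y : vector_field) (sign : R) :
  (forall x y, D y -> same_point x y -> U x) ->
  (forall x s, U (x s) ->
     (forall mu, ex_derive (fun u => x u mu) s) ->
     (forall mu, ex_derive (fun u => velocity x u mu) s) ->
     chain_rule_L L x s) ->
  (forall x s, U (x s) ->
     (forall mu, ex_derive (fun u => x u mu) s) ->
     chain_rule (xi Y) x s /\
     forall mu, chain_rule (fun u y => eta Y u y mu) x s) ->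
  noether_symmetry U L Y (fun _ _ => 0) ->
  sign = 1 \/ sign = -1 ->
  (forall s x v, U x -> T s x v = sign * noether_flow L Y s x v) ->
  conserved_flow_of D L Y T.
Proof.
intros HDU HL HY Hsym Hsign HT.
assert (HD : forall x, D x -> U x).
{ intros x Hx. apply (HDU x x Hx).
  repeat split; try reflexivity; exists 0%Z; simpl; ring. }
split; [ | split].
- intros s x v Hx. apply Hsym, HD, Hx.
- exists sign. split; [exact Hsign | ]. intros s x v Hx. apply HT, HD, Hx.
- intros a b x Hx s Ha Hb.
  apply (is_derive_ext_loc
           (fun u => sign * noether_flow L Y u (x u) (velocity x u))).
  { apply (locally_interval _ s a b Ha Hb). intros u Hau Hub.
    destruct (Hx u Hau Hub) as [[y [Hy Hxy]] _].
    symmetry. apply HT, (HDU _ _ Hy Hxy). }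
  destruct (Hx s Ha Hb) as [[y [Hy Hxy]] [H1 [H2 H3]]].
  pose proof (HDU _ _ Hy Hxy) as HU.
  destruct (HY x s HU H1) as [Hxi Heta].
  pose proof (noether_theorem L Y x s H2 H3 (HL x s HU H1 H2) Hxi Heta) as HN.
  evar_last; [exact (is_derive_scal _ _ sign _ HN) | ].
  rewrite (Hsym s (x s) (velocity x s) HU).
  unfold total_D, partial, csum. rewrite !Derive_const. ring.
Qed.

(** * Biaxial Lagrangians *)

Definition biaxial (A B C E : R -> R) : lagrangian_fun := fun _ x v =>
  A (x c_r) * v c_t ^ 2 + B (x c_r) * v c_r ^ 2
  + C (x c_r) * (v c_theta ^ 2 + sin (x c_theta) ^ 2 * v c_phi ^ 2)
  + E (x c_r) * (v c_psi + cos (x c_theta) * v c_phi) ^ 2.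

Definition biaxial_regular (A B C E : R -> R) (x : vec) : Prop :=
  sin (x c_theta) <> 0 /\ ex_derive A (x c_r) /\ ex_derive B (x c_r) /\
  ex_derive C (x c_r) /\ ex_derive E (x c_r).

Definition biaxial_dx (A B C E : R -> R) (x v : vec) (mu : coord) : R :=
  match mu with
  | c_r => biaxial (Derive A) (Derive B) (Derive C) (Derive E) 0 x v
  | c_theta =>
      2 * sin (x c_theta) * v c_phi
      * (C (x c_r) * cos (x c_theta) * v c_phi
         - E (x c_r) * (v c_psi + cos (x c_theta) * v c_phi))
  | _ => 0
  end.

Definition biaxial_dv (A B C E : R -> R) (x v : vec) (mu : coord) : R :=
  match mu with
  | c_t => 2 * A (x c_r) * v c_t
  | c_r => 2 * B (x c_r) * v c_r
  | c_theta => 2 * C (x c_r) * v c_theta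
  | c_phi => 2 * C (x c_r) * sin (x c_theta) ^ 2 * v c_phi
             + 2 * E (x c_r) * cos (x c_theta)
               * (v c_psi + cos (x c_theta) * v c_phi)
  | c_psi => 2 * E (x c_r) * (v c_psi + cos (x c_theta) * v c_phi)
  end.

Lemma dL_dx_biaxial (A B C E : R -> R) (s : R) (x v : vec) (mu : coord) :
  biaxial_regular A B C E x ->
  dL_dx (biaxial A B C E) s x v mu = biaxial_dx A B C E x v mu.
Proof.
intros [_ [HA [HB [HC HE]]]].
unfold dL_dx, partial, biaxial. apply is_derive_unique.
destruct mu; unfold upd; simpl; auto_derive; auto; unfold biaxial;
  change (fun u : R => A u) with A; change (fun u : R => B u) with B;
  change (fun u : R => C u) with C; change (fun u : R => E u) with E; ring.
Qed.

Lemma dL_dv_biaxial (A B C E : R -> R) (s : R) (x v : vec) (mu : coord) :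
  dL_dv (biaxial A B C E) s x v mu = biaxial_dv A B C E x v mu.
Proof.
unfold dL_dv, partial, biaxial. apply is_derive_unique.
destruct mu; unfold upd; simpl; auto_derive; auto; ring.
Qed.

(** The chain rule for the Lagrangian, with the components of the curve and of
    its velocity replaced by independent functions of the parameter. *)
Lemma biaxial_derive (A B C E r th vt vr vth vph vps : R -> R) (s : R)
    (dr dth dvt dvr dvth dvph dvps : R) :
  ex_derive A (r s) -> ex_derive B (r s) -> ex_derive C (r s) ->
  ex_derive E (r s) ->
  is_derive r s dr -> is_derive th s dth -> is_derive vt s dvt ->
  is_derive vr s dvr -> is_derive vth s dvth -> is_derive vph s dvph ->
  is_derive vps s dvps ->
  is_derive (fun u => A (r u) * vt u ^ 2 + B (r u) * vr u ^ 2
      + C (r u) * (vth u ^ 2 + sin (th u) ^ 2 * vph u ^ 2)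
      + E (r u) * (vps u + cos (th u) * vph u) ^ 2) s
    (dr * (Derive A (r s) * vt s ^ 2 + Derive B (r s) * vr s ^ 2
           + Derive C (r s) * (vth s ^ 2 + sin (th s) ^ 2 * vph s ^ 2)
           + Derive E (r s) * (vps s + cos (th s) * vph s) ^ 2)
     + dth * (2 * sin (th s) * vph s
              * (C (r s) * cos (th s) * vph s
                 - E (r s) * (vps s + cos (th s) * vph s)))
     + dvt * (2 * A (r s) * vt s) + dvr * (2 * B (r s) * vr s)
     + dvth * (2 * C (r s) * vth s)
     + dvph * (2 * C (r s) * sin (th s) ^ 2 * vph s
              + 2 * E (r s) * cos (th s) * (vps s + cos (th s) * vph s))
     + dvps * (2 * E (r s) * (vps s + cos (th s) * vph s))).
Proof.
intros HA HB HC HE Hr Hth Ht Hvr Hvth Hvph Hvps.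
auto_derive.
- repeat split; trivial; eexists; eassumption.
- change (fun u : R => A u) with A. change (fun u : R => B u) with B.
  change (fun u : R => C u) with C. change (fun u : R => E u) with E.
  rewrite <- (is_derive_unique _ _ _ Hr), <- (is_derive_unique _ _ _ Hth),
    <- (is_derive_unique _ _ _ Ht), <- (is_derive_unique _ _ _ Hvr),
    <- (is_derive_unique _ _ _ Hvth), <- (is_derive_unique _ _ _ Hvph),
    <- (is_derive_unique _ _ _ Hvps).
  change (fun u : R => r u) with r. change (fun u : R => th u) with th.
  change (fun u : R => vt u) with vt. change (fun u : R => vr u) with vr.
  change (fun u : R => vth u) with vth. change (fun u : R => vph u) with vph.
  change (fun u : R => vps u) with vps. ring.
Qed.

Lemma chain_rule_biaxial (A B C E : R -> R) (x : R -> vec) (s : R) :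
  biaxial_regular A B C E (x s) ->
  (forall mu, ex_derive (fun u => x u mu) s) ->
  (forall mu, ex_derive (fun u => velocity x u mu) s) ->
  chain_rule_L (biaxial A B C E) x s.
Proof.
intros HU Hx Hv. unfold chain_rule_L, csum.
rewrite !dL_dx_biaxial by exact HU. rewrite !dL_dv_biaxial.
destruct HU as [_ [HA [HB [HC HE]]]].
assert (Hd : forall mu, is_derive (fun u => x u mu) s (velocity x s mu)).
{ intros mu. apply Derive_correct, Hx. }
assert (Hdd : forall mu, is_derive (fun u => velocity x u mu) s
                           (velocity (velocity x) s mu)).
{ intros mu. apply Derive_correct, Hv. }
unfold biaxial at 1 2. rewrite Derive_const.
evar_last.
- exact (biaxial_derive _ _ _ _ _ _ _ _ _ _ _ s _ _ _ _ _ _ _ HA HB HC HE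
    (Hd c_r) (Hd c_theta) (Hdd c_t) (Hdd c_r) (Hdd c_theta) (Hdd c_phi)
    (Hdd c_psi)).
- unfold biaxial_dx, biaxial_dv, biaxial. ring.
Qed.

(** * Cyclic variables *)

Lemma chain_rule_const (c : R) (x : R -> vec) (s : R) :
  chain_rule (fun _ _ => c) x s.
Proof.
unfold chain_rule, total_D, partial, csum. rewrite !Derive_const.
auto_derive; auto; ring.
Qed.

Lemma total_D_const (c s : R) (x v : vec) : total_D (fun _ _ => c) s x v = 0.
Proof. unfold total_D, partial, csum. rewrite !Derive_const. ring. Qed.

(** The fields considered are the constant combinations of [d/ds], [d/dt],
    [d/dphi] and [d/dpsi], none of which variables the Lagrangian contains. *)
Lemma constant_field_symmetry (A B C E : R -> R) (c : R) (e : coord -> R) :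
  e c_r = 0 -> e c_theta = 0 ->
  noether_symmetry (biaxial_regular A B C E) (biaxial A B C E)
    (VectorField (fun _ _ => c) (fun _ _ => e)) (fun _ _ => 0).
Proof.
intros Hr Ht s x v HU. unfold prolong1, csum; cbn [xi eta].
rewrite !total_D_const, !dL_dx_biaxial by exact HU.
unfold biaxial. rewrite Derive_const. simpl. rewrite Hr, Ht. ring.
Qed.

Lemma constant_field_flow (A B C E : R -> R) (c : R) (e : coord -> R)
    (D : vec -> Prop) (T : lagrangian_fun) (sign : R) :
  (forall x y, D y -> same_point x y -> biaxial_regular A B C E x) ->
  e c_r = 0 -> e c_theta = 0 ->
  sign = 1 \/ sign = -1 ->
  (forall s x v, T s x v = sign *
     (c * biaxial A B C E s x v
      + csum (fun mu => (e mu - v mu * c) * biaxial_dv A B C E x v mu))) ->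
  conserved_flow_of D (biaxial A B C E)
    (VectorField (fun _ _ => c) (fun _ _ => e)) T.
Proof.
intros HD Hr Ht Hsign HT.
apply (noether_conserved_flow _ (biaxial_regular A B C E) _ _ _ sign).
- exact HD.
- apply chain_rule_biaxial.
- intros x s _ _. split.
  + apply (chain_rule_const c).
  + intros mu. apply (chain_rule_const (e mu)).
- apply constant_field_symmetry; assumption.
- exact Hsign.
- intros s x v _. rewrite HT. unfold noether_flow, csum; cbn [xi eta].
  rewrite !dL_dv_biaxial. reflexivity.
Qed.

(** * Rotations *)

(** The vector [a dtheta + b cot theta dphi] generates a rotation of the sphere
    when [a' = b] and [b' = - a]; the [psi] component makes it preserve
    [dpsi + cos theta dphi]. *)
Definition rotation_field (a b : R -> R) : vector_field :=
  VectorField (fun _ _ => 0) (fun _ x mu =>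
    match mu with
    | c_theta => a (x c_phi)
    | c_phi => b (x c_phi) * cot (x c_theta)
    | c_psi => - (b (x c_phi) * csc (x c_theta))
    | _ => 0
    end).

(** The total derivatives of the components, with [b' = - a]. *)
Definition rotation_dot (a b : R -> R) (x v : vec) (mu : coord) : R :=
  match mu with
  | c_theta => b (x c_phi) * v c_phi
  | c_phi => - a (x c_phi) * (cos (x c_theta) / sin (x c_theta)) * v c_phi
             - b (x c_phi) / sin (x c_theta) ^ 2 * v c_theta
  | c_psi => a (x c_phi) / sin (x c_theta) * v c_phi
             + b (x c_phi) * cos (x c_theta) / sin (x c_theta) ^ 2 * v c_theta
  | _ => 0
  end.

Lemma cos_sqr (u : R) : cos u ^ 2 = 1 - sin u ^ 2.
Proof. generalize (sin2_cos2 u); unfold Rsqr; nra. Qed.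

Lemma is_derive_cot (u : R) : sin u <> 0 -> is_derive cot u (- / sin u ^ 2).
Proof.
intros H. apply (is_derive_ext (fun w : R => cos w / sin w)); [reflexivity | ].
auto_derive; [exact H | ].
pose proof (cos_sqr u) as Hc.
field_simplify_eq; [ | exact H]. ring [Hc].
Qed.

Lemma is_derive_csc (u : R) :
  sin u <> 0 -> is_derive csc u (- (cos u / sin u ^ 2)).
Proof.
intros H. apply (is_derive_ext (fun w : R => / sin w)); [reflexivity | ].
auto_derive; [exact H | ]. field. exact H.
Qed.

Lemma rotation_derive (a b : R -> R) (x : R -> vec) (v : vec) (s : R)
    (mu : coord) :
  (forall u, is_derive a u (b u)) ->
  (forall u, is_derive b u (- a u)) ->
  sin (x s c_theta) <> 0 ->
  is_derive (fun u => x u c_theta) s (v c_theta) ->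
  is_derive (fun u => x u c_phi) s (v c_phi) ->
  is_derive (fun u => eta (rotation_field a b) u (x u) mu) s
    (rotation_dot a b (x s) v mu).
Proof.
intros Ha Hb Hs Ht Hp.
pose proof (is_derive_comp _ _ _ _ _ (Ha _) Hp) as Hap.
pose proof (is_derive_comp _ _ _ _ _ (Hb _) Hp) as Hbp.
pose proof (is_derive_comp _ _ _ _ _ (is_derive_cot _ Hs) Ht) as Hcot.
pose proof (is_derive_comp _ _ _ _ _ (is_derive_csc _ Hs) Ht) as Hcsc.
destruct mu; simpl.
- apply @is_derive_const.
- apply @is_derive_const.
- evar_last; [exact Hap | ]. unfold scal; simpl; unfold mult; simpl. ring.
- evar_last.
  { apply (@is_derive_mult R_AbsRing _ _ _ _ _ Hbp Hcot). exact Rmult_comm. }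
  unfold plus, scal; simpl; unfold mult; simpl. unfold cot. field. exact Hs.
- evar_last.
  { apply @is_derive_opp.
    apply (@is_derive_mult R_AbsRing _ _ _ _ _ Hbp Hcsc). exact Rmult_comm. }
  unfold opp, plus, scal; simpl; unfold mult; simpl. unfold csc. field. exact Hs.
Qed.

(** The partial derivatives are the derivatives along the coordinate lines,
    so [rotation_derive] gives them too. *)
Lemma total_D_rotation (a b : R -> R) (s : R) (x v : vec) (mu : coord) :
  (forall u, is_derive a u (b u)) ->
  (forall u, is_derive b u (- a u)) ->
  sin (x c_theta) <> 0 ->
  total_D (fun u y => eta (rotation_field a b) u y mu) s x v
  = rotation_dot a b x v mu.
Proof.
intros Ha Hb Hs. unfold total_D.
assert (HP : forall nu, partial (fun y => eta (rotation_field a b) s y mu) x nu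
                        = rotation_dot a b x (dx nu) mu).
{ intros nu. unfold partial. apply is_derive_unique.
  assert (Hx : forall rho, upd x nu (x nu) rho = x rho).
  { intros rho. unfold upd. destruct (coord_eq_dec nu rho); congruence. }
  evar_last.
    apply (rotation_derive a b (fun h => upd x nu h) (dx nu)).
    - exact Ha.
    - exact Hb.
    - rewrite Hx. exact Hs.
    - unfold upd, dx. destruct (coord_eq_dec nu c_theta); auto_derive; auto.
    - unfold upd, dx. destruct (coord_eq_dec nu c_phi); auto_derive; auto.
  unfold rotation_dot. rewrite !Hx. reflexivity. }
unfold csum. rewrite !HP. simpl. rewrite Derive_const.
destruct mu; unfold rotation_dot, dx; simpl; field; auto.
Qed.

(** Writing [w = vpsi + cos theta vphi], both [vtheta^2 + sin^2 theta vphi^2]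
    and [w] are invariant under the prolonged field: the coefficients of
    [C (r)] and of [E (r)] vanish separately. *)
Lemma rotation_symmetry (a b A B C E : R -> R) :
  (forall u, is_derive a u (b u)) ->
  (forall u, is_derive b u (- a u)) ->
  noether_symmetry (biaxial_regular A B C E) (biaxial A B C E)
    (rotation_field a b) (fun _ _ => 0).
Proof.
intros Ha Hb s x v HU. pose proof HU as [Hs _]. unfold prolong1, csum.
rewrite !total_D_rotation by assumption.
rewrite !dL_dx_biaxial by exact HU. rewrite !dL_dv_biaxial.
cbn [xi eta rotation_field]. rewrite !total_D_const.
unfold rotation_dot, biaxial_dx, biaxial_dv, cot, csc.
pose proof (cos_sqr (x c_theta)) as Hc.
field_simplify_eq; [ | exact Hs]. ring [Hc].
Qed.

Lemma rotation_flow (a b A B C E : R -> R) (D : vec -> Prop)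
    (T : lagrangian_fun) :
  (forall u, is_derive a u (b u)) ->
  (forall u, is_derive b u (- a u)) ->
  (forall x y, D y -> same_point x y -> biaxial_regular A B C E x) ->
  (forall s x v, sin (x c_theta) <> 0 ->
     T s x v
     = a (x c_phi) * biaxial_dv A B C E x v c_theta
       + b (x c_phi) * cot (x c_theta) * biaxial_dv A B C E x v c_phi
       - b (x c_phi) * csc (x c_theta) * biaxial_dv A B C E x v c_psi) ->
  conserved_flow_of D (biaxial A B C E) (rotation_field a b) T.
Proof.
intros Ha Hb HD HT.
apply (noether_conserved_flow _ (biaxial_regular A B C E) _ _ _ 1).
- exact HD.
- apply chain_rule_biaxial.
- intros x s [Hs _] Hx. split; [apply (chain_rule_const 0) | ].
  intros mu. unfold chain_rule. rewrite total_D_rotation by assumption.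
  apply rotation_derive; try assumption; apply Derive_correct, Hx.
- apply rotation_symmetry; assumption.
- left; reflexivity.
- intros s x v [Hs _]. rewrite HT by exact Hs.
  unfold noether_flow, csum. rewrite !dL_dv_biaxial.
  cbn [xi eta rotation_field]. ring.
Qed.

(** * The charged squashed Kaluza-Klein black hole *)

(** The dependence on [psi] disappears by [cos^2 psi + sin^2 psi = 1], at every
    point, so that the two Lagrangians are equal as functions. *)
Lemma Lagr_biaxial (M q rinf : R) :
  Lagr M q rinf =
  biaxial (fun r => - bh_f M q r) (fun r => bh_k M q rinf r ^ 2 / bh_f M q r)
          (fun r => r ^ 2 / 4 * bh_k M q rinf r) (fun r => r ^ 2 / 4).
Proof.
apply functional_extensionality; intros s.
apply functional_extensionality; intros x.
apply functional_extensionality; intros v.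
unfold Lagr, biaxial, csum, metric, sigma1, sigma2, sigma3, dx; simpl coord_eq_dec.
cbv iota beta zeta.
set (B := bh_k M q rinf (x c_r) ^ 2 / bh_f M q (x c_r)).
pose proof (cos_sqr (x c_theta)) as H1. pose proof (cos_sqr (x c_psi)) as H2.
ring [H1 H2].
Qed.

(** At [theta = 0] the forms [sigma1], [sigma2], [sigma3] all vanish on
    [dphi - dpsi], so the metric is degenerate there. *)
Lemma region_sin_theta (M q rinf : R) (x : vec) :
  region M q rinf x -> sin (x c_theta) <> 0.
Proof.
intros [_ [[H0 H1] [_ [_ [_ Hnd]]]]].
destruct (Rle_lt_or_eq_dec _ _ H0) as [Hpos | Hz].
- apply Rgt_not_eq, sin_gt_0; assumption.
- exfalso.
  assert (H : dx c_phi c_phi - dx c_psi c_phi = 0).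
  { refine (Hnd (fun mu => dx c_phi mu - dx c_psi mu) _ c_phi).
    intros mu. unfold csum, metric, sigma1, sigma2, sigma3.
    rewrite <- Hz, sin_0, cos_0.
    destruct mu; unfold dx; simpl; ring. }
  unfold dx in H; simpl in H. lra.
Qed.

(** The denominators are [f (r)], [r] and [r^2 - rinf^2], nonzero in the region;
    [r] and [theta] are unchanged by the periods of the angles. *)
Lemma region_regular (M q rinf : R) (x y : vec) :
  region M q rinf y -> same_point x y ->
  biaxial_regular (fun r => - bh_f M q r)
    (fun r => bh_k M q rinf r ^ 2 / bh_f M q r)
    (fun r => r ^ 2 / 4 * bh_k M q rinf r) (fun r => r ^ 2 / 4) x.
Proof.
intros HD [_ [Hr [Ht _]]]. unfold biaxial_regular. rewrite Hr, Ht.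
pose proof (region_sin_theta _ _ _ _ HD) as Hs.
destruct HD as [[Hr0 Hr1] [_ [_ [_ [Hf _]]]]].
set (r := y c_r) in *.
assert (Hd : r ^ 2 - rinf ^ 2 <> 0) by nra.
assert (Hr' : r <> 0) by lra.
assert (H2 : r ^ 2 <> 0) by (apply pow_nonzero; exact Hr').
assert (H4 : r ^ 4 <> 0) by (apply pow_nonzero; exact Hr').
assert (Hd2 : (r ^ 2 - rinf ^ 2) ^ 2 <> 0) by (apply pow_nonzero; exact Hd).
assert (Ef : ex_derive (bh_f M q) r).
{ unfold bh_f. auto_derive. repeat split; assumption. }
assert (Ek : ex_derive (bh_k M q rinf) r).
{ unfold bh_k. auto_derive. exact Hd2. }
repeat split; [exact Hs | | | | ]; auto_derive; auto.
Qed.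

(** The two fields differ by where the sign stands in the components. *)
Lemma Y6_rotation : Y6 = rotation_field cos (fun u => - sin u).
Proof.
unfold Y6, rotation_field. f_equal.
apply functional_extensionality; intros s.
apply functional_extensionality; intros x.
apply functional_extensionality; intros mu.
destruct mu; ring.
Qed.

Theorem mainTheorem8 (M q rinf : R) (hrinf : 0 < rinf) :
  let f := bh_f M q in
  let k := bh_k M q rinf in
  let L := Lagr M q rinf in
  let D := region M q rinf in
  (forall (s : R) (x v : vec), D x ->
     L s x v =
       - f (x c_r) * v c_t ^ 2
       + k (x c_r) ^ 2 / f (x c_r) * v c_r ^ 2
       + x c_r ^ 2 / 4 * k (x c_r) * v c_theta ^ 2
       + x c_r ^ 2 / 4
         * (k (x c_r) * sin (x c_theta) ^ 2 + cos (x c_theta) ^ 2) * v c_phi ^ 2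
       + x c_r ^ 2 / 2 * cos (x c_theta) * v c_phi * v c_psi
       + x c_r ^ 2 / 4 * v c_psi ^ 2) /\
  conserved_flow_of D L Y1 L /\
  conserved_flow_of D L Y2 (fun _ x v => - 2 * f (x c_r) * v c_t) /\
  conserved_flow_of D L Y3 (fun _ x v =>
    x c_r ^ 2 / 2
      * (k (x c_r) * sin (x c_theta) ^ 2 + cos (x c_theta) ^ 2) * v c_phi
    + x c_r ^ 2 / 2 * cos (x c_theta) * v c_psi) /\
  conserved_flow_of D L Y4 (fun _ x v =>
    x c_r ^ 2 / 2 * cos (x c_theta) * v c_phi + x c_r ^ 2 / 2 * v c_psi) /\
  conserved_flow_of D L Y5 (fun _ x v =>
    x c_r ^ 2 / 2 * k (x c_r) * sin (x c_phi) * v c_theta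
    + x c_r ^ 2 / 4 * (k (x c_r) - 1) * sin (2 * x c_theta) * cos (x c_phi) * v c_phi
    + x c_r ^ 2 / 2
      * (cos (x c_theta) * cos (x c_phi) * cot (x c_theta)
         - cos (x c_phi) * csc (x c_theta)) * v c_psi) /\
  conserved_flow_of D L Y6 (fun _ x v =>
    x c_r ^ 2 / 2 * k (x c_r) * cos (x c_phi) * v c_theta
    - x c_r ^ 2 / 4 * (k (x c_r) - 1) * sin (2 * x c_theta) * sin (x c_phi) * v c_phi
    + x c_r ^ 2 / 2
      * (sin (x c_phi) * csc (x c_theta)
         - cos (x c_theta) * sin (x c_phi) * cot (x c_theta)) * v c_psi).
Proof.
intros f k L D.
pose proof (region_regular M q rinf) as HD.
unfold L. rewrite Lagr_biaxial.
split; [ | split; [ | split; [ | split; [ | split; [ | split]]]]].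
- intros s x v _. unfold biaxial. fold f k.
  generalize (k (x c_r) ^ 2 / f (x c_r)). intros B. field.
- (* With [c = 1] the flow is the Lagrangian minus [v^mu dL/dv^mu], which is
     minus the Lagrangian by homogeneity of degree 2. *)
  apply (constant_field_flow _ _ _ _ 1 (fun _ => 0) _ _ (-1)); auto.
  intros s x v. unfold csum, biaxial, biaxial_dv. ring.
- apply (constant_field_flow _ _ _ _ 0 (dx c_t) _ _ 1); auto.
  intros s x v. unfold csum, biaxial_dv, dx; simpl. fold f k. ring.
- apply (constant_field_flow _ _ _ _ 0 (dx c_phi) _ _ 1); auto.
  intros s x v. unfold csum, biaxial_dv, dx; simpl. fold f k.
  unfold Rdiv. generalize (/ f (x c_r)). intros g. field.
- apply (constant_field_flow _ _ _ _ 0 (dx c_psi) _ _ 1); auto.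
  intros s x v. unfold csum, biaxial_dv, dx; simpl. fold f k.
  unfold Rdiv. generalize (/ f (x c_r)). intros g. field.
- apply (rotation_flow sin cos);
    [exact is_derive_sin | exact is_derive_cos | exact HD | ].
  intros s x v Hs. unfold biaxial_dv, cot, csc. fold f k. rewrite sin_2a.
  pose proof (cos_sqr (x c_theta)) as Hc.
  field_simplify_eq; [ | exact Hs]. ring [Hc].
- rewrite Y6_rotation.
  apply (rotation_flow cos (fun u => - sin u)).
  + exact is_derive_cos.
  + intros u. auto_derive; [exact I | ring].
  + exact HD.
  + intros s x v Hs. unfold biaxial_dv, cot, csc. fold f k. rewrite sin_2a.
    pose proof (cos_sqr (x c_theta)) as Hc.
    field_simplify_eq; [ | exact Hs]. ring [Hc].
Qed.
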